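(* Let $q$ be an odd prime power, $\delta\in\mathbb{F}_{q^2}$ and $\gamma\in\mathbb{F}_q^*$. Then the polynomial $$f(x)=(x^q-x+\delta)^{2q+4}+(x^q-x+\delta)^{q+5}+\gamma x$$ is a permutation polynomial of $\mathbb{F}_{q^2}$ if and only if one of the following holds: (i) $\mathrm{Tr}_q^{q^2}(\delta)=0$; (ii) $\mathrm{Tr}_q^{q^2}(\delta)\neq0$, $q\equiv\pm2\pmod 5$ and $40\gamma=19\left(\mathrm{Tr}_q^{q^2}(\delta)\right)^5$; (iii) $\mathrm{Tr}_q^{q^2}(\delta)\neq0$, $5\mid q$ and $2\gamma=\left(\mathrm{Tr}_q^{q^2}(\delta)\right)^5$.
   Context: A polynomial over a finite field $\mathbb{F}$ is a permutation polynomial of $\mathbb{F}$ if the map it induces on $\mathbb{F}$ is a bijection. For $x\in\mathbb{F}_{q^2}$, $\mathrm{Tr}_q^{q^2}(x)=x+x^q$. *)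

(* Defs.v *)
From mathcomp Require Import all_boot all_order all_algebra all_field.
From mathcomp Require Import ring.

Set Implicit Arguments.
Unset Strict Implicit.
Unset Printing Implicit Defensive.

Import GRing.Theory.
Local Open Scope ring_scope.

Definition permutation_poly (F : finFieldType) (f : {poly F}) : Prop :=
  bijective (fun x : F => f.[x]).

(* The copy of F_q inside F, as the fixed field of x |-> x^q.  When F has
   q^2 elements it is the subfield with q elements: see [Fq_divring_closed]
   and [card_Fq]. *)
Definition Fq (q : nat) (F : finFieldType) : {pred F} :=
  [pred x | x ^+ q == x].
Arguments Fq : clear implicits.

Definition Tr (q : nat) (F : finFieldType) (x : F) : F := x + x ^+ q.

Lemma Fq_divring_closed (p k : nat) (F : finFieldType) :
  prime p -> #|F| = ((p ^ k) ^ 2)%N -> divring_closed (Fq (p ^ k) F).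
Proof.
move=> p_pr cardF.
have charFp : p \in [pchar F].
  by apply: (@card_finPcharP F p (k * 2)) => //; rewrite expnM.
have pnat : [pchar F].-nat (p ^ k)%N.
  by rewrite pnatX (eq_pnat _ (pcharf_eq charFp)) pnat_id.
split=> [|x y|x y]; rewrite !inE ?expr1n //.
  by move=> /eqP xq /eqP yq; rewrite exprDn_pchar // exprNn_pchar // xq yq.
by move=> /eqP xq /eqP yq; rewrite exprMn exprVn xq yq.
Qed.

Lemma card_Fq (q : nat) (F : finFieldType) :
  (1 < q)%N -> #|F| = (q ^ 2)%N -> #|Fq q F| = q.
Proof.
move=> q_gt1 cardF; set P : {poly F} := 'X^q - 'X.
have szP : size P = q.+1.
  by rewrite /P size_polyDl size_polyXn // size_polyN size_polyX.
have dvdP : P %| \prod_(x <- enum F) ('X - x%:P).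
  rewrite big_enum -finField_genPoly cardF.
  have -> : P = 'X * ('X^(q.-1) - 1).
    by rewrite mulrBr mulr1 -exprS prednK // ltnW.
  have -> : (q ^ 2 = (q.-1 * q.+1).+1)%N.
    by case: (q) q_gt1 => // n _; rewrite -!mulnn /= mulnS !mulSn; ring.
  have -> : 'X^((q.-1 * q.+1).+1) - 'X = 'X * (('X^(q.-1)) ^+ q.+1 - 1) :> {poly F}.
    by rewrite mulrBr mulr1 exprS exprM.
  by rewrite [('X^_ ^+ _ - 1)]subrX1 mulrA dvdp_mulIl.
have [m] := dvdp_prod_XsubC dvdP.
set s := mask m _ => Ps.
have us : uniq s by rewrite mask_uniq ?enum_uniq.
have -> : #|Fq q F| = size s.
  rewrite -(card_uniqP us); apply: eq_card => x.
  rewrite -root_prod_XsubC -(eqp_root Ps) rootE /P !hornerE.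
  by rewrite ?hornerXn subr_eq0 inE.
by apply/succn_inj; rewrite -szP (eqp_size Ps) size_prod_XsubC.
Qed.

(* Main.v *)
(* Let T = Tr delta.  For T = 0 the polynomial induces x |-> gamma x.  Otherwise
   put t = T / 2 and write x^q - x + delta = t + z; then z runs through the line
   L = {z | z^q = -z}, the values of f are T y^4 (T - y) + gamma x with y = t + z,
   and f(x + c) = f(x) + gamma c for c in F_q.  Since f(x)^q - f(x) equals
   4 t h(z) plus a constant, where h(z) = z^5 + a z^3 + b z, a = 2 t^2 and
   4 t b = gamma - 12 t^5, f permutes F_{q^2} if and only if h is injective on L.

   Necessity, 5 not dividing q: Hermite's criterion on L.  If 5 s = q - 1 + 2 w
   and 5 s < 2 (q - 1), then the sum of h(z)^s over L is both 0 and the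
   coefficient of X^w in (1 + a X + b X^2)^s.  For q = 1, 4 mod 5 the choices
   w = 0, 1 are contradictory; for q = 2, 3 mod 5 suitable w give 5 b = a^2.

   Necessity, 5 dividing q: h(z + w) - h(z) factors as w (D(w) + (t s)^2) with
   s = z + w / 2 and D(w) = w^4 - a w^2 + b, so D takes nonzero square values on
   L minus 0 and D^((q-1)/2) = 1 there.  As D^((q-1)/2) satisfies
   2 D E' + D' E = 0, its coefficients obey a three-term recurrence, which is
   compatible with that periodicity only if a^2 = 4 b.

   Sufficiency: for 5 b = a^2 a collision of h on L yields a square root of 5 in
   F_q, hence a fifth root of unity in F_{q^2}, impossible for q = 2, 3 mod 5.
   For 5 | q and a^2 = 4 b it yields (w^2 - t^2)^2 = (2 t s)^2, whose square roots
   lie in F_q and in L respectively, so both vanish and w = t or -t lies in both. *)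

Require Import Defs.
From mathcomp Require Import all_boot all_order all_algebra all_field.
From mathcomp Require Import ring zify.

Set Implicit Arguments.
Unset Strict Implicit.
Unset Printing Implicit Defensive.

Import GRing.Theory.
Local Open Scope ring_scope.

(** Reduces a goal to an identity for [ring] or [field]: [c] is the cofactor that writes [x - y] as
    a multiple of the relation [u - v]. Chained uses combine several relations. *)
Lemma eq_lincomb (K : comPzRingType) (c u v x y : K) :
  u = v -> x - y = c * (u - v) -> x = y.
Proof. by move=> -> /eqP; rewrite subrr mulr0 subr_eq0 => /eqP. Qed.

Lemma coef_exp_pchar (K : fieldType) (p : nat) (P : {poly K}) (i : nat) :
  p \in [pchar K] ->
  (P ^+ p)`_i = if (p %| i)%N then P`_(i %/ p) ^+ p else 0.
Proof.
move=> charK; have p_gt0 := prime_gt0 (pcharf_prime charK).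
have charP : p \in [pchar {poly K}] by rewrite pchar_poly.
have -> : P ^+ p = \sum_(j < size P) P`_j ^+ p *: 'X^(j * p).
  rewrite -(pFrobenius_autE charP) -{1}[P]coefK poly_def rmorph_sum.
  by apply: eq_bigr => j _; rewrite /= pFrobenius_autE exprZn exprM.
rewrite coef_sumMXn; case: ifP => [/dvdnP[m ->]|ndvd]; last first.
  by rewrite big_pred0 // => j; apply/eqP => E; rewrite -E dvdn_mull in ndvd.
rewrite mulnK //; case: (ltnP m (size P)) => [ltm | lem].
  by rewrite (big_pred1 (Ordinal ltm)) // => j; rewrite eqn_pmul2r.
rewrite nth_default // expr0n eqn0Ngt p_gt0 big_pred0 // => j.
by rewrite eqn_pmul2r // ltn_eqF // (leq_trans (ltn_ord j)).
Qed.

Section CubeTimes.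
Variables (K : fieldType) (A B : {poly K}).
Hypothesis char3 : 3%N \in [pchar K].

(** By Frobenius, [B ^+ 3] only has terms of degree divisible by 3. The indices 3, 7 and 9 are those
    met when q is a power of 3. *)
Lemma coef3_mul_cube : (A * B ^+ 3)`_3 = A`_0 * B`_1 ^+ 3 + A`_3 * B`_0 ^+ 3.
Proof.
rewrite coefM !big_ord_recl big_ord0 !(coef_exp_pchar _ _ char3) /=.
by rewrite !subSS ?subn0 /= !mulr0 !add0r addr0.
Qed.

Lemma coef7_mul_cube :
  (A * B ^+ 3)`_7 = A`_1 * B`_2 ^+ 3 + A`_4 * B`_1 ^+ 3 + A`_7 * B`_0 ^+ 3.
Proof.
rewrite coefM !big_ord_recl big_ord0 !(coef_exp_pchar _ _ char3) /=.
by rewrite !subSS ?subn0 /= !mulr0 !add0r addr0 addrA.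
Qed.

Lemma coef9_mul_cube :
  (A * B ^+ 3)`_9 =
    A`_0 * B`_3 ^+ 3 + A`_3 * B`_2 ^+ 3 + A`_6 * B`_1 ^+ 3 + A`_9 * B`_0 ^+ 3.
Proof.
rewrite coefM !big_ord_recl big_ord0 !(coef_exp_pchar _ _ char3) /=.
by rewrite !subSS ?subn0 /= !mulr0 !add0r addr0 !addrA.
Qed.

End CubeTimes.

(** * Coefficients of powers *)

Section TrinomialPowers.
Variables (K : fieldType) (a b : K).

(* The reversed polynomial: [quintic a b z = z ^+ 5 * (tri a b).[z ^- 2]]. *)
Definition tri : {poly K} := 1 + a *: 'X + b *: 'X^2.

Lemma size_tri_exp s : (size (tri ^+ s) <= (2 * s).+1)%N.
Proof.
have sz : (size tri <= 3)%N.
  by apply/leq_sizeP => -[|[|[|j]]] // _; rewrite !coefE /= !mulr0 !addr0.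
apply: leq_trans (size_poly_exp_leq _ _) _.
by rewrite ltnS leq_mul //; case: (size _) sz.
Qed.

Lemma coef0_tri_exp s : (tri ^+ s)`_0 = 1.
Proof.
by rewrite -horner_coef0 !hornerE /= !mulr0 addr0 expr1n.
Qed.

Lemma deriv_tri : tri^`() = a%:P + (2%:R * b) *: 'X.
Proof.
by rewrite /tri -polyC1 !derivE add0r alg_polyC /= expr1 -scalerMnr scalerMnl mulr_natl.
Qed.

(** Logarithmic derivative of a power, cleared of denominators; its coefficients give the three-term
    recurrence below. *)
Lemma tri_mul_deriv s :
  tri * (tri ^+ s)^`() = s%:R *: ((a%:P + (2%:R * b) *: 'X) * tri ^+ s).
Proof.
rewrite deriv_exp deriv_tri; case: s => [|s]; first by rewrite mulr0n mulr0 scale0r.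
by rewrite /= exprS scaler_nat; ring.
Qed.

Lemma coef1_tri_exp s : (tri ^+ s)`_1 = s%:R * a.
Proof.
have := congr1 (fun Q : {poly K} => Q`_0) (tri_mul_deriv s).
rewrite /= !(mulrDl, coefD, coefZ, coefCM, mul1r) -!scalerAl !coefZ.
by rewrite !(coefXnM, coefXM) /= !coef_deriv coef0_tri_exp !mulr0 !addr0 mulr1n mulr1.
Qed.

Lemma coef_tri_exp_rec s n :
  n.+2%:R * (tri ^+ s)`_n.+2 =
    (s%:R - n.+1%:R) * a * (tri ^+ s)`_n.+1
    + (2%:R * s%:R - n%:R) * b * (tri ^+ s)`_n.
Proof.
have E := congr1 (fun Q : {poly K} => Q`_n.+1) (tri_mul_deriv s).
rewrite !(mulrDl, coefD, coefZ, coefCM, mul1r) -!scalerAl !coefZ in E.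
rewrite !(coefXnM, coefXM) !coef_deriv subSS subn1 in E.
move: ((tri ^+ s)) E => c E.
have {}E : n.+2%:R * c`_n.+2 + a * (n.+1%:R * c`_n.+1) + b * (n%:R * c`_n) =
         s%:R * (a * c`_n.+1 + (b + b) * c`_n).
  rewrite !(mulr_natl _ n) !(mulr_natl _ n.+1) !(mulr_natl _ n.+2).
  have -> : c`_n *+ n = if (n.+1 < 2)%N then 0 else c`_n.-1.+1 *+ n.-1.+1.
    by case: (n) => [|m] //=; rewrite mulr0n.
  exact: E.
by apply: (eq_lincomb (c := 1) E); ring.
Qed.

(** With x = 5 s the recurrence gives 50 c_2 = x ((x - 5) a^2 + 10 b), which is 6 (5 b - a^2) for x
    = 3. *)
Lemma coef2_tri_exp_eq0 s : 2%:R != 0 :> K -> 3%:R != 0 :> K ->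
  5%:R * s%:R = 3%:R :> K -> (tri ^+ s)`_2 = 0 -> 5%:R * b = a ^+ 2.
Proof.
move=> n2 n3 sE c2; have n6 : 6%:R != 0 :> K by rewrite (natrM _ 2 3) mulf_neq0.
have := coef_tri_exp_rec s 0; rewrite c2 coef0_tri_exp coef1_tri_exp mulr0 => /esym E.
apply: (mulfI n6); apply: (eq_lincomb (c := 1) (etrans (congr1 ( *%R 25%:R) E) (mulr0 _))).
pose x := 5%:R * s%:R : K.
transitivity (x * ((x - 5%:R) * a ^+ 2 + 10%:R * b)); last by rewrite /x; ring.
by rewrite /x sE; ring.
Qed.

(** For s = 7/5 the recurrence gives 4 c_4 = (28/625) (5 b - a^2) (5 b - 2 a^2). *)
Lemma coef4_tri_exp_eq0 s :
  [/\ 2%:R != 0 :> K, 3%:R != 0 :> K, 5%:R != 0 :> K & 7%:R != 0 :> K] ->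
  5%:R * s%:R = 7%:R :> K -> (tri ^+ s)`_4 = 0 ->
  5%:R * b = a ^+ 2 \/ 5%:R * b = 2%:R * a ^+ 2.
Proof.
move=> [n2 n3 n5 n7] /(canRL (mulKf n5)) sE c4E.
have n25 : 25%:R != 0 :> K by rewrite (natrM _ 5 5) mulf_neq0.
have n125 : 125%:R != 0 :> K by rewrite (natrM _ 25 5) mulf_neq0.
have r2 := coef_tri_exp_rec s 0; have r3 := coef_tri_exp_rec s 1.
have r4 := coef_tri_exp_rec s 2.
rewrite !coef0_tri_exp !coef1_tri_exp c4E !sE in r2 r3 r4.
have c2E : (tri ^+ s)`_2 = 7%:R / 25%:R * (a ^+ 2 + 5%:R * b).
  by apply: (mulfI n2); rewrite r2; field; rewrite n25 n5.
have c3E : (tri ^+ s)`_3 = 7%:R / 125%:R * (a * (10%:R * b - a ^+ 2)).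
  by apply: (mulfI n3); rewrite r3 c2E; field; rewrite n25 n125 n5.
have n28 : 28%:R != 0 :> K by rewrite (natrM _ 4 7) mulf_neq0 // (natrM _ 2 2) mulf_neq0.
have : (5%:R * b - a ^+ 2) * (5%:R * b - 2%:R * a ^+ 2) == 0.
  apply/eqP; apply: (mulfI n28); rewrite c2E c3E !mulr0 in r4 *.
  by apply: (eq_lincomb (c := - 625%:R) r4); field; rewrite n25 n125 n5.
by rewrite mulf_eq0 !subr_eq0 => /orP[] /eqP; [left | right].
Qed.

(** Runs the recurrence for s = 17/5 along the branch 5 b = 2 a^2, parametrized by [e], in order to
    exclude that branch. *)
Lemma coef9_tri_exp s (e : K) :
  [/\ 2%:R != 0 :> K, 3%:R != 0 :> K, 5%:R != 0 :> K & 7%:R != 0 :> K] ->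
  5%:R * s%:R = 17%:R :> K -> a = 5%:R * e -> b = 10%:R * e ^+ 2 ->
  (tri ^+ s)`_9 = 17%:R * e ^+ 9.
Proof.
move=> [n2 n3 n5 n7] /(canRL (mulKf n5)) sE aE bE.
have n4 : 4%:R != 0 :> K by rewrite (natrM _ 2 2) mulf_neq0.
have n6 : 6%:R != 0 :> K by rewrite (natrM _ 2 3) mulf_neq0.
have n8 : 8%:R != 0 :> K by rewrite (natrM _ 2 4) mulf_neq0.
have n9 : 9%:R != 0 :> K by rewrite (natrM _ 3 3) mulf_neq0.
have c0E := coef0_tri_exp s.
have c1E : (tri ^+ s)`_1 = 17%:R * e by rewrite coef1_tri_exp sE aE; field.
have rec n := coef_tri_exp_rec s n.
have c2E : (tri ^+ s)`_2 = 136%:R * e ^+ 2.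
  by apply: (mulfI n2); rewrite rec c1E c0E sE aE bE; field.
have c3E : (tri ^+ s)`_3 = 646%:R * e ^+ 3.
  by apply: (mulfI n3); rewrite rec c2E c1E sE aE bE; field.
have c4E : (tri ^+ s)`_4 = 1955%:R * e ^+ 4.
  by apply: (mulfI n4); rewrite rec c3E c2E sE aE bE; field.
have c5E : (tri ^+ s)`_5 = (18683%:R / 5%:R) * e ^+ 5.
  by apply: (mulfI n5); rewrite rec c4E c3E sE aE bE; field.
have c6E : (tri ^+ s)`_6 = (20706%:R / 5%:R) * e ^+ 6.
  by apply: (mulfI n6); rewrite rec c5E c4E sE aE bE; field.
have c7E : (tri ^+ s)`_7 = (9588%:R / 5%:R) * e ^+ 7.
  by apply: (mulfI n7); rewrite rec c6E c5E sE aE bE; field.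
have c8E : (tri ^+ s)`_8 = (- (867%:R / 5%:R)) * e ^+ 8.
  by apply: (mulfI n8); rewrite rec c7E c6E sE aE bE; field.
by apply: (mulfI n9); rewrite rec c8E c7E sE aE bE; field.
Qed.

Lemma coef_tri_exp_big s i : (2 * s < i)%N -> (tri ^+ s)`_i = 0.
Proof. by move=> lt_i; apply/nth_default/(leq_trans (size_tri_exp s)). Qed.

Lemma coef_tri_sqr : (tri ^+ 2)`_3 = 2%:R * a * b /\ (tri ^+ 2)`_4 = b ^+ 2.
Proof.
by rewrite expr2 !coefM !big_ord_recl !big_ord0 /= !coefE /=; split; ring.
Qed.

End TrinomialPowers.

(** * Powers of a biquadratic with exponent -1/2 in K *)

Section BiquadraticPowers.
Variables (K : fieldType) (a b : K) (N : nat).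
Hypotheses (two_neq0 : 2%:R != 0 :> K) (N_half : 2%:R * N%:R = -1 :> K).

Definition biquad : {poly K} := 'X^4 - a *: 'X^2 + b%:P.

Lemma deriv_biquad : biquad^`() = 4%:R *: 'X^3 - (2%:R * a) *: 'X.
Proof.
rewrite /biquad !derivE /= addr0 scaler_nat mul1r mulr1; congr (_ - _).
by rewrite scalerDr -scalerDl -mulr2n mulr_natl.
Qed.

Lemma biquad_mul_deriv :
  2%:R *: (biquad * (biquad ^+ N)^`()) + biquad^`() * biquad ^+ N = 0.
Proof.
have -> : biquad * (biquad ^+ N)^`() = N%:R *: (biquad^`() * biquad ^+ N).
  rewrite deriv_exp; case: (N) => [|n]; first by rewrite mulr0n mulr0 scale0r.
  by rewrite /= exprS scaler_nat; ring.
by rewrite scalerA N_half scaleN1r addNr.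
Qed.

Lemma coef_biquad_exp_rec n :
  (n%:R + 2%:R) * (biquad ^+ N)`_n - a * (n%:R + 3%:R) * (biquad ^+ N)`_n.+2
    + b * (n%:R + 4%:R) * (biquad ^+ N)`_n.+4 = 0.
Proof.
have E := congr1 (fun Q : {poly K} => Q`_n.+3) biquad_mul_deriv.
rewrite deriv_biquad /biquad -/biquad in E.
rewrite !(mulrDl, mulNr, coefD, coefN, coefZ, coefCM) -!scalerAl !coefZ in E.
rewrite !(coefXnM, coefXM) !coef_deriv !subSS !subn0 coef0 /= in E.
move: (biquad ^+ N) E => e.
have -> : (if (n.+3 < 4)%N then 0 else e`_(n - 1).+1 *+ (n - 1).+1) = e`_n *+ n.
  by case: (n) => [|m] //=; rewrite ?mulr0n // subn1.
rewrite -(mulr_natl _ n) -(mulr_natl _ n.+2) -(mulr_natl _ n.+4) => E.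
by apply: (mulfI two_neq0); rewrite mulr0; apply: (eq_lincomb (c := 1) E); ring.
Qed.

(** This is the recurrence above at n = -2, where its first term drops out. *)
Lemma coef2_biquad_exp : 2%:R * b * (biquad ^+ N)`_2 = a * (biquad ^+ N)`_0.
Proof.
have E := congr1 (fun Q : {poly K} => Q`_1) biquad_mul_deriv.
rewrite deriv_biquad /biquad -/biquad in E.
rewrite !(mulrDl, mulNr, coefD, coefN, coefZ, coefCM) -!scalerAl !coefZ in E.
rewrite !(coefXnM, coefXM) !coef_deriv coef0 /= in E.
by apply: (mulfI two_neq0); apply: (eq_lincomb (c := 1) E); ring.
Qed.

Lemma biquad_monic : biquad \is monic /\ size biquad = 5.
Proof.
pose P : {poly K} := - (a *: 'X^2) + b%:P.
have sz : (size P < size ('X^4 : {poly K}))%N.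
  rewrite size_polyXn ltnS; apply/leq_sizeP => -[|[|[|[|j]]]] // _;
    by rewrite /P !coefE /= mulr0 oppr0 addr0.
rewrite /biquad -addrA -/P; split; last by rewrite size_polyDl // size_polyXn.
by rewrite monicE lead_coefDl // lead_coefXn.
Qed.

Lemma size_biquad_exp : size (biquad ^+ N) = (4 * N).+1.
Proof.
have [mon sz] := biquad_monic; have := size_exp biquad N; rewrite sz /= => <-.
by rewrite prednK // size_poly_gt0 monic_neq0 // monic_exp.
Qed.

Lemma lead_coef_biquad_exp : (biquad ^+ N)`_(4 * N) = 1.
Proof.
have [mon sz] := biquad_monic; apply/eqP.
by have := monic_exp N mon; rewrite monicE lead_coefE size_biquad_exp.
Qed.

End BiquadraticPowers.

(* Solving the recurrence of [coef_biquad_exp_rec] downwards from the leading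
   coefficient [e (2 * (q - 1)) = 1], upwards from [e 0], and gluing both ends
   with [e i = e (i + (q - 1))] overdetermines [a] and [b]. *)
Lemma biquad_recurrence_solve (K : fieldType) (a b : K) (q : nat) (e : nat -> K) :
  q%:R = 0 :> K -> (5 <= q)%N -> a != 0 ->
  (forall n, (n%:R + 2%:R) * e n - a * (n%:R + 3%:R) * e n.+2
               + b * (n%:R + 4%:R) * e n.+4 = 0) ->
  2%:R * b * e 2%N = a * e 0%N ->
  e (2 * q.-1)%N = 1 -> e 0%N = e q.-1 ->
  (forall i j, (0 < i)%N -> (0 < j)%N -> (i + j = q.-1)%N -> e i = e (i + q.-1)%N) ->
  a ^+ 2 = 4%:R * b.
Proof.
move=> q0 q5 a0 rec rec2 lead e0 ei.
have q_nat (n m : nat) : (n + m = q)%N -> n%:R = - m%:R :> K.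
  by move=> nm; apply/eqP; rewrite -addr_eq0 -natrD nm q0.
have q2_nat (n m : nat) : (n + m = 2 * q)%N -> n%:R = - m%:R :> K.
  by move=> nm; apply/eqP; rewrite -addr_eq0 -natrD nm natrM q0 mulr0.
have eA : 2%:R * e (2 * q - 4)%N = a.
  have := rec (2 * q - 4)%N; have -> : ((2 * q - 4).+2 = 2 * q.-1)%N by lia.
  rewrite lead (q2_nat (2 * q - 4) 4)%N; last by lia.
  by move=> R; apply: (eq_lincomb (c := -1) R); ring.
have eB : 8%:R * e (2 * q - 6)%N = 3%:R * a ^+ 2 - 4%:R * b.
  have := rec (2 * q - 6)%N; have -> : ((2 * q - 6).+4 = 2 * q.-1)%N by lia.
  have -> : ((2 * q - 6).+2 = 2 * q - 4)%N by lia.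
  rewrite lead (q2_nat (2 * q - 6) 6)%N; last by lia.
  move=> R; apply: (eq_lincomb (c := -2%:R) R).
  by apply: (eq_lincomb (c := 3%:R * a) eA); ring.
(* Periodicity moves index 2 to q + 1, and at n = q - 3 the middle term of the recurrence
   vanishes. *)
have eC : e (q - 3)%N = b * e 2%N.
  have -> : e 2%N = e q.+1 by rewrite (ei 2 (q - 3))%N; [congr e | | |]; lia.
  have := rec (q - 3)%N; have -> : ((q - 3).+4 = q.+1)%N by lia.
  rewrite (q_nat (q - 3) 3)%N; last by lia.
  by move=> R; apply: (eq_lincomb (c := -1) R); ring.
have eD : e (q - 3)%N = e (2 * q - 4)%N.
  by rewrite (ei (q - 3) 2)%N; [congr e | | |]; lia.
have eF : e 0%N = 1 by apply: (mulfI a0); rewrite -rec2 -mulrA -eC eD eA mulr1.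
have eG : e (q - 5)%N = e (2 * q - 6)%N.
  have [qE|qE] := eqVneq q 5%N; first by rewrite qE in e0 *; rewrite e0.
  by rewrite (ei (q - 5) 4)%N; [congr e | | |]; lia.
(* All three values in the recurrence at n = q - 5 are now known in terms of a and b. *)
have := rec (q - 5)%N; have -> : ((q - 5).+4 = q.-1)%N by lia.
have -> : ((q - 5).+2 = q - 3)%N by lia.
rewrite (q_nat (q - 5) 5)%N; last by lia.
rewrite eD eG -e0 eF => R; apply: (eq_lincomb (c := -8%:R) R).
apply: (eq_lincomb (c := -3%:R) eB).
by apply: (eq_lincomb (c := 8%:R * a) eA); ring.
Qed.


(** * The trace-zero line *)

Definition antiFq (q : nat) (F : finFieldType) : {pred F} :=
  [pred z | z ^+ q == - z].
Arguments antiFq : clear implicits.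

Definition quintic (K : fieldType) (a b z : K) : K := z ^+ 5 + a * z ^+ 3 + b * z.

Section QuadraticExtension.
Variables (p k q : nat) (F : finFieldType).
Hypotheses (p_pr : prime p) (k_gt0 : (0 < k)%N) (qE : q = (p ^ k)%N).
Hypotheses (q_odd : odd q) (cardF : #|F| = (q ^ 2)%N).

Lemma q_gt2 : (2 < q)%N.
Proof.
have : (p ^ 1 <= q)%N by rewrite qE leq_exp2l // prime_gt1.
by have := prime_gt1 p_pr; case: (q) q_odd => [|[|[|]]] //; lia.
Qed.

Lemma pchar_F : p \in [pchar F].
Proof. by apply: (@card_finPcharP F p (k * 2)) => //; rewrite cardF qE expnM. Qed.

Lemma natq0 : q%:R = 0 :> F.
Proof. by apply/eqP; rewrite -(dvdn_pcharf pchar_F) qE dvdn_exp. Qed.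

Lemma p_odd : odd p.
Proof. by move: q_odd; rewrite qE oddX; case: k k_gt0. Qed.

Lemma natF_neq0 n : ~~ (p %| n)%N -> n%:R != 0 :> F.
Proof. by rewrite (dvdn_pcharf pchar_F). Qed.

Lemma two_neq0 : 2%:R != 0 :> F.
Proof.
apply: natF_neq0; apply/negP => /(dvdn_leq (isT : (0 < 2)%N)).
by have := prime_gt1 p_pr; have := p_odd; case: (p) => [|[|[|]]].
Qed.

Lemma exprDq (x y : F) : (x + y) ^+ q = x ^+ q + y ^+ q.
Proof.
by apply: exprDn_pchar; rewrite qE pnatX (eq_pnat _ (pcharf_eq pchar_F)) pnat_id.
Qed.

Lemma exprNq (x : F) : (- x) ^+ q = - x ^+ q.
Proof. by rewrite exprNn -signr_odd q_odd mulN1r. Qed.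

Lemma exprqK (x : F) : (x ^+ q) ^+ q = x.
Proof. by rewrite -exprM mulnn -cardF expf_card. Qed.

Lemma natrXq n : n%:R ^+ q = n%:R :> F.
Proof.
elim: n => [|n IHn]; last by rewrite -addn1 natrD exprDq IHn expr1n.
by rewrite expr0n; case: (q) q_odd.
Qed.

Lemma exprq1_Fq (x : F) : x \in Fq q F -> x != 0 -> x ^+ q.-1 = 1.
Proof.
rewrite inE => /eqP xq x0; apply: (mulfI x0).
by rewrite -exprS prednK ?mulr1 // ltnW // ltnW // q_gt2.
Qed.

Lemma exprq1_anti (z : F) : z \in antiFq q F -> z != 0 -> z ^+ q.-1 = -1.
Proof.
rewrite inE => /eqP zq z0; apply: (mulfI z0).
by rewrite -exprS prednK ?mulrN1 // ltnW // ltnW // q_gt2.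
Qed.

Lemma Fq_anti0 (z : F) : z \in Fq q F -> z \in antiFq q F -> z = 0.
Proof.
rewrite !inE => /eqP -> /eqP E; apply: (mulfI two_neq0).
by rewrite mulr0 mulr_natl mulr2n {1}E addNr.
Qed.

Lemma anti_neq0_ex : exists2 w : F, w \in antiFq q F & w != 0.
Proof.
case: (pickP [pred x : F | x \notin Fq q F]) => [x /= xnF | allF].
  exists (x ^+ q - x); last by rewrite subr_eq0.
  by rewrite inE exprDq exprNq exprqK opprB addrC.
have : #|Fq q F| = #|F| by apply: eq_card => x; have /negbFE -> := allF x.
rewrite (card_Fq (ltnW q_gt2) cardF) cardF -mulnn => E.
by have := q_gt2; nia.
Qed.

(** For x nonzero and N = (q^2 - 1) / 2, a multiple of q - 1, x^N = 1; so X^2 - x divides X^(q^2) -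
    X, which splits over F. *)
Lemma sqrt_Fq (x : F) : x \in Fq q F -> exists r : F, r ^+ 2 = x.
Proof.
have [-> _ | x0 xF] := eqVneq x 0; first by exists 0; rewrite expr0n.
pose N := (q.-1 * (q./2).+1)%N.
have q2 : (q ^ 2 = (2 * N).+1)%N.
  rewrite /N -mulnn; have := odd_double_half q; rewrite q_odd -addnn.
  by move: (q./2) => m <-; nia.
have dvdP : 'X^2 - x%:P %| \prod_(y <- enum F) ('X - y%:P).
  rewrite big_enum -finField_genPoly cardF.
  have -> : 'X^(q ^ 2) - 'X = 'X * ('X^2 ^+ N - x%:P ^+ N) :> {poly F}.
    rewrite -exprM -polyC_exp.
    have -> : x ^+ N = 1 by rewrite /N exprM exprq1_Fq // expr1n.
    by rewrite mulrBr mulr1 -exprS -q2.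
  by rewrite subrXX mulrCA dvdp_mulIl.
have [m] := dvdp_prod_XsubC dvdP; set s := mask m _ => Ps.
have := eqp_size Ps; rewrite size_prod_XsubC size_XnsubC //.
case: s Ps => [|r s] // Ps _; exists r.
have : root ('X^2 - x%:P) r by rewrite (eqp_root Ps) root_prod_XsubC inE eqxx.
by rewrite rootE !hornerE subr_eq0 => /eqP.
Qed.

Lemma cardFq : #|Fq q F| = q.
Proof. exact: card_Fq (ltnW q_gt2) cardF. Qed.

Lemma q1_gt0 : (0 < q.-1)%N.
Proof. by have := q_gt2; case: (q) => [|[|]]. Qed.

(** * Power sums and Hermite's criterion *)

Lemma mem0_Fq : 0 \in Fq q F.
Proof. by rewrite inE expr0n; case: (q) q_odd. Qed.

Lemma mem_Fq_mull (x y : F) : x \in Fq q F -> x != 0 -> (x * y \in Fq q F) = (y \in Fq q F).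
Proof. by rewrite !inE exprMn => /eqP -> x0; rewrite (inj_eq (mulfI x0)). Qed.

Lemma mem_anti_mull (w u : F) : w \in antiFq q F -> w != 0 ->
  (w * u \in antiFq q F) = (u \in Fq q F).
Proof.
by rewrite !inE exprMn => /eqP -> w0; rewrite mulNr eqr_opp (inj_eq (mulfI w0)).
Qed.

(** With r = j mod (q - 1), the polynomial X^r - 1 has at most r < q - 1 roots, too few for all of
    F_q^*. *)
Lemma Fq_pow_neq1 j : ~~ (q.-1 %| j)%N ->
  exists g : F, [/\ g \in Fq q F, g != 0 & g ^+ j != 1].
Proof.
move=> ndvd; set U := [pred u : F | (u \in Fq q F) && (u != 0)].
case: (pickP [pred g in U | g ^+ j != 1]) => [g /= /andP[/andP[? ?] ?]|all1].
  by exists g.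
pose r := (j %% q.-1)%N; have r_gt0 : (0 < r)%N by rewrite lt0n.
have q1_gt0 := q1_gt0.
have rootU : all (root ('X^r - 1%:P)) (enum U).
  apply/allP => u; rewrite mem_enum => uU; rewrite rootE !hornerE subr_eq0.
  have := all1 u; rewrite /= uU /= => /negbFE/eqP uj.
  move: uU uj => /andP[uF u0]; rewrite (divn_eq j q.-1) exprD mulnC exprM.
  by rewrite exprq1_Fq // expr1n mul1r => ->.
have Xr0 : 'X^r - 1%:P != 0 :> {poly F} by rewrite -size_poly_gt0 size_XnsubC.
have := max_poly_roots Xr0 rootU (enum_uniq _); rewrite size_XnsubC // -cardE.
have cardU : (#|U|.+1 = q)%N.
  rewrite -[RHS]cardFq [RHS](cardD1 0) mem0_Fq add1n; congr _.+1.
  by apply: eq_card => u; rewrite !inE andbC.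
have : (r < q.-1)%N by rewrite ltn_mod.
by move: cardU; rewrite /r /U /=; set n := #|_|; lia.
Qed.

(** If q - 1 does not divide j, substituting g u for u multiplies the sum by g^j != 1. Otherwise
    each nonzero u contributes 1. *)
Lemma sum_Fq_pow j : (0 < j)%N ->
  \sum_(u in Fq q F) u ^+ j = if (q.-1 %| j)%N then -1 else 0.
Proof.
move=> j_gt0; case: ifP => [/dvdnP[m jE] | /negbT ndvd].
  have := sumr_const (Fq q F) (1 : F); rewrite cardFq natq0.
  rewrite (bigD1 0) ?mem0_Fq //= => E.
  rewrite (bigD1 0) ?mem0_Fq //= expr0n eqn0Ngt j_gt0 add0r.
  have -> : \sum_(u in Fq q F | u != 0) u ^+ j = \sum_(u in Fq q F | u != 0) 1.
    apply: eq_bigr => u /andP[uF u0].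
    by rewrite jE mulnC exprM exprq1_Fq // expr1n.
  by apply/eqP; rewrite -addr_eq0 addrC E.
have [g [gF g0 gj]] := Fq_pow_neq1 ndvd.
have E : \sum_(u in Fq q F) u ^+ j = g ^+ j * \sum_(u in Fq q F) u ^+ j.
  rewrite [LHS](reindex_inj (mulfI g0)) /= mulr_sumr.
  by apply: eq_big => [u | u _]; rewrite ?mem_Fq_mull // exprMn.
move/eqP: E; rewrite -subr_eq0 -{1}[\sum_(_ in _) _]mul1r -mulrBl mulf_eq0 subr_eq0.
by rewrite eq_sym (negbTE gj) => /eqP.
Qed.

(** Substituting z = w u, with w nonzero on the line, gives a sum over F_q; the sign comes from w^(q
    - 1) = -1. *)
Lemma sum_anti_pow j : (0 < j)%N ->
  \sum_(z in antiFq q F) z ^+ j =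
    if (q.-1 %| j)%N then - (-1) ^+ (j %/ q.-1) else 0.
Proof.
have [w wA w0] := anti_neq0_ex.
move=> j_gt0; rewrite (reindex_inj (mulfI w0)) /=.
under eq_big do [rewrite mem_anti_mull // | rewrite exprMn].
rewrite -mulr_sumr sum_Fq_pow //; case: ifP => [jE | _]; last by rewrite mulr0.
rewrite mulrN1 -{1}(divnK jE) mulnC exprM exprq1_anti //.
Qed.

Lemma sum_anti_const (c : F) : \sum_(z in antiFq q F) c = 0.
Proof.
have [w wA w0] := anti_neq0_ex.
rewrite (reindex_inj (mulfI w0)) /=.
under eq_bigl do rewrite mem_anti_mull //.
by rewrite sumr_const cardFq -mulr_natl natq0 mul0r.
Qed.

(** Below degree 3 (q - 1) only the exponents q - 1 and 2 (q - 1) have a nonzero power sum; exponent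
    0 contributes q = 0. *)
Lemma sum_anti_poly (P : {poly F}) : (size P <= 3 * q.-1)%N ->
  \sum_(z in antiFq q F) P.[z] = P`_(q.-1) - P`_(2 * q.-1).
Proof.
have q1_gt0 := q1_gt0.
move=> szP; under eq_bigr do rewrite (horner_coef_wide _ szP).
rewrite exchange_big /=; under eq_bigr do rewrite -mulr_sumr.
have i1 : (q.-1 < 3 * q.-1)%N by lia.
have i2 : (2 * q.-1 < 3 * q.-1)%N by lia.
rewrite (bigD1 (Ordinal i1)) // (bigD1 (Ordinal i2)) /=; last first.
  by apply/eqP => /(congr1 val) /=; lia.
rewrite !sum_anti_pow ?muln_gt0 ?q1_gt0 // dvdnn dvdn_mull // divnn q1_gt0 mulnK //.
rewrite expr1 opprK mulr1 sqrrN expr1n mulrN1 addrA big1 ?addr0 // => i /andP[/eqP n1 /eqP n2].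
have {}n1 : (val i != q.-1)%N by apply/eqP => E; apply: n1; apply: val_inj.
have {}n2 : (val i != 2 * q.-1)%N by apply/eqP => E; apply: n2; apply: val_inj.
have [i0 | i_gt0] := posnP i.
  by under eq_bigr do rewrite i0 expr0; rewrite sum_anti_const mulr0.
rewrite sum_anti_pow //; case: ifP => [/dvdnP[m iE] | _]; last by rewrite mulr0.
have := ltn_ord i; rewrite [X in (X < _)%N]iE ltn_pmul2r // => m_lt.
move: n1 n2 i_gt0; rewrite /= iE.
by case: (m) m_lt => [|[|[|?]]]; rewrite ?mul1n ?eqxx.
Qed.

Variables (a b : F).
Hypotheses (aF : a \in Fq q F) (bF : b \in Fq q F).

Lemma quintic_anti (z : F) : z \in antiFq q F -> quintic a b z \in antiFq q F.
Proof.
move: aF bF; rewrite !inE => /eqP aE /eqP bE /eqP zE.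
rewrite /quintic !exprDq (exprMn q a) (exprMn q b) aE bE (exprAC _ 5) (exprAC _ 3) zE.
by apply/eqP; ring.
Qed.

(** Expands z^(5 s) [tri](z^-2)^s in powers of z; since w <= 2 s, the subtraction in the exponent
    never truncates. *)
Definition quintic_exp (s : nat) : {poly F} :=
  \sum_(w < (2 * s).+1) (tri a b ^+ s)`_w *: 'X^(5 * s - 2 * w).

Lemma horner_quintic_exp s (z : F) : (quintic_exp s).[z] = quintic a b z ^+ s.
Proof.
rewrite horner_sum; have [-> | z0] := eqVneq z 0.
  case: s => [|s].
    by rewrite big_ord1 coef0_tri_exp !hornerE expr0.
  rewrite /quintic !expr0n /= !mulr0 !addr0 expr0n big1 // => w _.
  by rewrite !hornerE expr0n; have := ltn_ord w; case: eqP => [|_ _]; [lia | rewrite mulr0].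
have -> : quintic a b z = z ^+ 5 * (tri a b).[z ^- 2].
  by rewrite /quintic /tri !hornerE /=; field.
rewrite exprMn -horner_exp (horner_coef_wide _ (size_tri_exp a b s)) mulr_sumr.
apply: eq_bigr => w _; rewrite hornerZ hornerXn [RHS]mulrCA; congr (_ * _).
have -> : (z ^+ 5) ^+ s = z ^+ (5 * s - 2 * w) * z ^+ (2 * w).
  by rewrite -exprD subnK ?exprM //; have := ltn_ord w; lia.
by rewrite exprVn -exprM mulfK // expf_neq0.
Qed.

(** Injectivity makes h permute L, so h^s and z^s have equal sums, and s < q - 1 makes the latter 0.
    In the expansion, exponent q - 1 occurs only at index w, and 2 (q - 1) exceeds the degree. *)
Lemma hermite s w : {in antiFq q F &, injective (quintic a b)} ->
  (0 < s)%N -> (5 * s = q.-1 + 2 * w)%N -> (5 * s < 2 * q.-1)%N ->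
  (tri a b ^+ s)`_w = 0.
Proof.
move=> hinj s_gt0 sE s_lt.
have sumE : \sum_(z in antiFq q F) quintic a b z ^+ s = \sum_(z in antiFq q F) z ^+ s.
  pose A := [set z | z \in antiFq q F].
  have hA : quintic a b @: A = A.
    apply/eqP; rewrite eqEcard; apply/andP; split.
      by apply/subsetP => y /imsetP[z]; rewrite inE => zA ->; rewrite inE quintic_anti.
    by rewrite card_in_imset // => y z; rewrite !inE; apply: hinj.
  have big_A (G : F -> F) : \sum_(z in antiFq q F) G z = \sum_(z in A) G z.
    by apply: eq_bigl => z; rewrite !inE.
  rewrite !big_A -[in RHS]hA big_imset // => y z; rewrite !inE; exact: hinj.
move: sumE; under eq_bigr do rewrite -horner_quintic_exp.
have szQ : (size (quintic_exp s) <= (5 * s).+1)%N.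
  apply: leq_trans (size_sum _ _ _) _; apply/bigmax_leqP => i _.
  apply: leq_trans (size_scale_leq _ _) _; rewrite size_polyXn; lia.
rewrite sum_anti_poly; last by lia.
rewrite [X in _ - X]nth_default ?subr0; last by apply: leq_trans szQ _; lia.
rewrite sum_anti_pow // gtnNdvd //; last by lia.
move=> E; rewrite -[RHS]E coef_sumMXn.
have w_lt : (w < (2 * s).+1)%N by lia.
rewrite (big_pred1 (Ordinal w_lt)) // => i /=; apply/eqP/eqP => [iE | -> /=]; last by lia.
by apply: val_inj => /=; have := ltn_ord i; lia.
Qed.


Lemma prime_neq0 r : prime r -> p != r -> r%:R != 0 :> F.
Proof. by move=> r_pr neq; apply: natF_neq0; rewrite dvdn_prime2. Qed.

Lemma natF_mul (m s n c : nat) : n%:R = 0 :> F -> (m * s = n + c)%N ->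
  m%:R * s%:R = c%:R :> F.
Proof. by move=> n0 E; rewrite -natrM E natrD n0 add0r. Qed.

(** In characteristic 5, 1/2 = 3 and -1/2 = 2, so [s] is the midpoint of the two arguments. The long
    cofactor collects the terms divisible by 5. *)
Lemma quintic_sub_char5 (t s w : F) : 5%:R = 0 :> F -> a = 2%:R * t ^+ 2 ->
  quintic a b (s + 3%:R * w) - quintic a b (s + 2%:R * w) =
    w * (w ^+ 4 - a * w ^+ 2 + b + (t * s) ^+ 2).
Proof.
move=> n5 at2; apply: (eq_lincomb (c := s ^+ 4 * w + 10%:R * s ^+ 3 * w ^+ 2 +
  38%:R * s ^+ 2 * w ^+ 3 + 65%:R * s * w ^+ 4 + 42%:R * w ^+ 5 +
  a * (3%:R * s * w ^+ 2 + 4%:R * w ^+ 3) + w * (t * s) ^+ 2) n5).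
by rewrite /quintic at2; ring.
Qed.

(** * Necessity *)

Section Necessity.
Hypothesis h_inj : {in antiFq q F &, injective (quintic a b)}.

Lemma q_mod5_neq1 : (q %% 5 != 1)%N.
Proof.
apply/eqP => q1; have q_div := divn_eq q 5; have q2 := q_gt2.
have := @hermite (q %/ 5) 0 h_inj; rewrite coef0_tri_exp.
by move=> H; have /eqP := oner_neq0 F; apply; apply: H; lia.
Qed.

Lemma q_mod5_neq4 : a != 0 -> (q %% 5 != 4)%N.
Proof.
move=> a0; apply/eqP => q4; have q_div := divn_eq q 5; have q2 := q_gt2.
have q_neq4 : (q != 4)%N by apply: contraL q_odd => /eqP ->.
(* Here s = (q + 1) / 5 is 1/5 in F, hence nonzero. *)
have := @hermite (q %/ 5).+1 1 h_inj; rewrite coef1_tri_exp => H.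
have {H} /eqP : (q %/ 5).+1%:R * a = 0 by apply: H; lia.
rewrite mulf_eq0 (negbTE a0) orbF => /eqP s0.
have := @natF_mul 5 (q %/ 5).+1 q 1 natq0; rewrite s0 mulr0 => H.
by have /eqP := oner_neq0 F; apply; rewrite -[1]H //; lia.
Qed.

Lemma quintic_mod5_2 : (q %% 5 = 2)%N -> p != 3%N -> 5%:R * b = a ^+ 2.
Proof.
move=> q2 p3; have q_div := divn_eq q 5; have q_gt2 := q_gt2.
have q_neq2 : (q != 2)%N by apply: contraL q_odd => /eqP ->.
apply: (@coef2_tri_exp_eq0 _ a b (q %/ 5).+1 two_neq0 (prime_neq0 _ p3)) => //.
  by apply: natF_mul natq0 _; lia.
(* Here w = 2 and s = (q + 3) / 5. *)
by apply: hermite => //; lia.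
Qed.

(* [w = 4] leaves the spurious root [5 b = 2 a^2], which [w = 9] excludes; for
   [q = 13] the latter is out of range. *)
Lemma quintic_mod5_3 : (q %% 5 = 3)%N -> (p %% 5 = 3)%N -> p != 3%N ->
  (q = 13%N -> 5%:R * b != 2%:R * a ^+ 2) -> 5%:R * b = a ^+ 2.
Proof.
move=> q3 pm p3 q13; have q_div := divn_eq q 5; have q_gt2 := q_gt2.
have q_ge13 : (13 <= q)%N.
  have := p_odd; have p_le : (p ^ 1 <= q)%N by rewrite qE leq_exp2l // prime_gt1.
  have : (p != 8)%N by apply: contraL p_odd => /eqP ->.
  by rewrite expn1 in p_le; have := divn_eq p 5; lia.
have neq0 : [/\ 2%:R != 0 :> F, 3%:R != 0 :> F, 5%:R != 0 :> F & 7%:R != 0 :> F].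
  by split; apply: prime_neq0 => //; apply: contra_eq_neq pm => ->.
have n17 : 17%:R != 0 :> F.
  by apply: prime_neq0 => //; apply: contra_eq_neq pm => ->.
have c4 : (tri a b ^+ (q %/ 5).+2)`_4 = 0 by apply: hermite => //; lia.
have s4 : 5%:R * (q %/ 5).+2%:R = 7%:R :> F by apply: natF_mul natq0 _; lia.
have [// | b2] := coef4_tri_exp_eq0 neq0 s4 c4.
have {}q13 : (q != 13)%N by apply/eqP => E; have := q13 E; rewrite b2 eqxx.
have q18 : (q != 18)%N by apply: contraL q_odd => /eqP ->.
(* Here s = (q + 17) / 5, and 5 s < 2 (q - 1) means q > 19. *)
have c9 : (tri a b ^+ (q %/ 5 + 4))`_9 = 0 by apply: hermite => //; lia.
have s9 : 5%:R * (q %/ 5 + 4)%:R = 17%:R :> F by apply: natF_mul natq0 _; lia.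
have [n2 n3 n5 n7] := neq0; pose e := a / 5%:R.
have aE : a = 5%:R * e by rewrite /e; field.
have bE : b = 10%:R * e ^+ 2 by apply: (mulfI n5); rewrite b2 aE; ring.
have /eqP := coef9_tri_exp neq0 s9 aE bE.
rewrite c9 eq_sym mulf_eq0 (negbTE n17) expf_eq0 /= => /eqP e0.
by rewrite bE aE e0; ring.
Qed.

Lemma tri_split s0 s1 n : tri a b ^+ (s0 + n * s1) = tri a b ^+ s0 * (tri a b ^+ s1) ^+ n.
Proof. by rewrite exprD mulnC exprM. Qed.

(* With [w = p + 2] and [s = s0 + p s1], Frobenius separates the base-[p] digits
   of [w], and only the product of the coefficients 2 and 1 survives. *)
Lemma quintic_mod5_3_p2 : a != 0 -> (q %% 5 = 3)%N -> (p %% 5 = 2)%N -> 5%:R * b = a ^+ 2.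
Proof.
move=> a0 q3 pm; have q_div := divn_eq q 5; have p_div := divn_eq p 5.
have p_ge7 : (7 <= p)%N.
  have : (p != 2)%N by apply: contraL p_odd => /eqP ->.
  by have := prime_gt1 p_pr; lia.
(* The exponent k is at least 2, since p and q differ modulo 5. *)
have [r qr] : exists r, q = (p * (p * r))%N.
  case: k k_gt0 qE => [|[|n]] // _; last by rewrite !expnS => ->; exists (p ^ n)%N.
  by rewrite expn1 => qp; move: pm; rewrite -qp q3.
have r_gt0 : (0 < r)%N by have := q_gt2; rewrite qr; case: (r) => //; rewrite !muln0.
have [s1 s1E] : exists s1, (p * r + 1 = 5 * s1)%N.
  exists ((p * r) %/ 5).+1; have := divn_eq (p * r) 5.
  suff : ((p * r) %% 5 = 4)%N by lia.
  have : ((p * r) %% 5 < 5)%N by rewrite ltn_mod.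
  move: q3; rewrite qr -modnMm pm; case: ((p * r) %% 5)%N => [|[|[|[|[|]]]]] //.
pose s0 := (p %/ 5).+1; have s0E : (5 * s0 = p + 3)%N by rewrite /s0; lia.
have p3 : p != 3%N by apply: contra_eq_neq pm => ->.
apply: (@coef2_tri_exp_eq0 _ a b s0 two_neq0 (prime_neq0 _ p3)) => //.
  exact: natF_mul (pcharf0 pchar_F) s0E.
have s1_neq0 : s1%:R != 0 :> F.
  have pr0 : (p * r)%:R = 0 :> F by rewrite natrM (pcharf0 pchar_F) mul0r.
  apply/eqP => s10; have := natF_mul pr0 (esym s1E); rewrite s10 mulr0.
  by move/esym/eqP; rewrite oner_eq0.
have := @hermite (s0 + p * s1) (p + 2) h_inj; rewrite tri_split => H.
have {H} : (tri a b ^+ s0 * (tri a b ^+ s1) ^+ p)`_(p + 2) = 0.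
  have q_ge : (p * 7 <= q)%N.
    by rewrite qr leq_mul2l (leq_trans p_ge7) ?orbT // leq_pmulr.
  have E : (5 * (s0 + p * s1) = p + 3 + (q + p))%N.
    by rewrite mulnDr s0E mulnCA -s1E mulnDr -qr muln1.
  by apply: H; have := q_gt2; lia.
have p2_lt : (2 < (p + 2).+1)%N by lia.
rewrite coefM (bigD1 (Ordinal p2_lt)) //= big1 ?addr0.
  rewrite addnK (coef_exp_pchar _ _ pchar_F) dvdnn divnn prime_gt0 // coef1_tri_exp.
  move/eqP; rewrite mulf_eq0 expf_eq0 mulf_eq0 (negbTE s1_neq0) (negbTE a0) /= andbF orbF.
  by move/eqP.
move=> j /eqP j2.
have {}j2 : (val j != 2)%N by apply/eqP => E; apply: j2; apply: val_inj.
rewrite (coef_exp_pchar _ _ pchar_F); case: ifP => [/dvdnP[m jE] | _]; last by rewrite mulr0.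
(* Here p + 2 - j = m p: m = 0 puts j above the degree 2 s0, m = 1 is the excluded j = 2, and m >= 2
   is too large. *)
have [m0 | m_gt0] := posnP m.
  rewrite nth_default ?mul0r //; apply: leq_trans (size_tri_exp _ _ _) _.
  by move: jE; rewrite m0; have := ltn_ord j; lia.
by case: m jE m_gt0 => [|[|m]] // jE _; have := ltn_ord j; move: j2 jE => /=; nia.
Qed.

(** * The case p = 3 *)

Lemma Fq_sqr_neqN1 (x : F) : (q %% 4 = 3)%N -> x \in Fq q F -> x ^+ 2 != -1.
Proof.
move=> q3; rewrite inE => /eqP xq; apply/eqP => x2.
have := xq; rewrite (divn_eq q 4) q3 exprD mulnC (exprM _ 4) (exprM _ 2 2) x2.
rewrite sqrrN !expr1n mul1r exprS x2 mulrN1 => /eqP; rewrite eq_sym -addr_eq0.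
rewrite -mulr2n -mulr_natl mulf_eq0 (negbTE two_neq0) => /eqP x0.
by move/eqP: x2; rewrite x0 expr0n eq_sym oppr_eq0 oner_eq0.
Qed.

(** Powers of 9 are 1 or 4 modulo 5 and 1 modulo 4, so the exponent k must be odd. *)
Lemma pow3_mod4 : p = 3%N -> (q %% 5 = 2)%N -> (q %% 4 = 3)%N.
Proof.
move=> p3; rewrite qE p3; have := odd_double_half k; rewrite -addnn.
move: (k./2) => j <-; have p9 : (9 ^ j %% 4 = 1)%N /\ ((9 ^ j %% 5 = 1)%N \/ (9 ^ j %% 5 = 4)%N).
  by elim: j => [|j [IH4 IH5]]; first (split; [|left]); rewrite // expnS; lia.
have -> : (3 ^ (odd k + (j + j)) = 3 ^ odd k * 9 ^ j)%N.
  by rewrite expnD addnn -mul2n expnM.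
by case: (odd k); rewrite ?expn0 ?expn1; lia.
Qed.

Lemma p3_dvd27 : p = 3%N -> (q %% 5 = 2)%N \/ (q %% 5 = 3)%N -> q != 3%N ->
  exists r, (q = 27 * r)%N /\ (0 < r)%N.
Proof.
move=> p3; rewrite qE p3; case: k k_gt0 => [|[|[|n]]] // _.
- by case.
by move=> _ _; exists (3 ^ n)%N; rewrite expn_gt0 !expnS !mulnA.
Qed.

(** In characteristic 3 the coefficient at w = 2 vanishes identically, so w = 7 and s = 2 + 3 s1 =
    (q + 13) / 5 are used. The result factors as a (b + a^2) ((b + 2 a^2)^2 + a^4), and a zero of
    the last factor would make -1 a square in F_q. *)
Lemma quintic_p3_mod5_2 : p = 3%N -> (q %% 5 = 2)%N -> a != 0 -> 5%:R * b = a ^+ 2.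
Proof.
move=> p3 q2 a0; have q_neq3 : q != 3%N by apply: contra_eq_neq q2 => ->.
have [r [qr r_gt0]] := p3_dvd27 p3 (or_introl q2) q_neq3.
have char3 : 3%N \in [pchar F] by rewrite -p3 pchar_F.
have three0 : 3%:R = 0 :> F := pcharf0 char3.
have [s1 s1E] : exists s1, (5 * s1 = 9 * r + 1)%N.
  by exists ((9 * r) %/ 5).+1; have := divn_eq (9 * r) 5; lia.
have := @hermite (2 + 3 * s1) 7 h_inj; rewrite tri_split (coef7_mul_cube _ _ char3) => H.
have {H} := H isT ltac:(lia) ltac:(lia).
have [_ ->] := coef_tri_sqr a b; rewrite (coef_tri_exp_big _ _ (s := 2) (i := 7)) //.
have s1F : s1%:R = -1 :> F.
  have r0 : (9 * r)%:R = 0 :> F by rewrite (natrM _ 9) (natrM _ 3 3) three0 !mul0r.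
  apply: (eq_lincomb (c := -1) (natF_mul r0 s1E)).
  by apply: (eq_lincomb (c := 2%:R * s1%:R) three0); ring.
have c2 : (tri a b ^+ s1)`_2 = a ^+ 2 - b.
  apply: (mulfI two_neq0); have -> := coef_tri_exp_rec a b s1 0.
  by rewrite coef0_tri_exp coef1_tri_exp s1F; ring.
rewrite c2 !coef1_tri_exp s1F mul0r addr0 => E.
have : a * ((b + a ^+ 2) * ((b + 2%:R * a ^+ 2) ^+ 2 + a ^+ 4)) == 0.
  rewrite -E; apply/eqP.
  apply: (eq_lincomb (c := a * (b ^+ 3 + 5%:R * a ^+ 4 * b + a ^+ 6)) three0).
  by ring.
rewrite !mulf_eq0 (negbTE a0) /= => /orP[/eqP b1 | /eqP b2].
  apply: (eq_lincomb (c := 5%:R) b1).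
  by apply: (eq_lincomb (c := - 2%:R * a ^+ 2) three0); ring.
have := @Fq_sqr_neqN1 ((b + 2%:R * a ^+ 2) / a ^+ 2) (pow3_mod4 p3 q2).
have -> : ((b + 2%:R * a ^+ 2) / a ^+ 2) ^+ 2 = -1.
  apply: (mulIf (expf_neq0 4 a0)); apply: (eq_lincomb (c := 1) b2); field.
  by rewrite a0.
rewrite eqxx => /(_ _)/negP []//.
have := aF; have := bF; rewrite !inE => /eqP bq /eqP aq.
by rewrite exprMn exprVn exprDq exprMn natrXq (exprAC a 2) bq aq.
Qed.

(** Here w = 9 and s = (q + 17) / 5. Two rounds of Frobenius reduce the coefficient to the cube of 2
    a b - a^3. *)
Lemma quintic_p3_mod5_3 : p = 3%N -> (q %% 5 = 3)%N -> q != 3%N -> a != 0 ->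
  5%:R * b = a ^+ 2.
Proof.
move=> p3 q3 q_neq3 a0.
have [r [qr r_gt0]] := p3_dvd27 p3 (or_intror q3) q_neq3.
have char3 : 3%N \in [pchar F] by rewrite -p3 pchar_F.
have three0 : 3%:R = 0 :> F := pcharf0 char3.
have [s2 s2E] : exists s2, (5 * s2 + 2 = 3 * r)%N.
  by exists ((3 * r) %/ 5)%N; have := divn_eq (3 * r) 5; lia.
have := @hermite (1 + 3 * (2 + 3 * s2)) 9 h_inj; rewrite tri_split (coef9_mul_cube _ _ char3) => H.
have {H} := H isT ltac:(lia) ltac:(lia).
have big i := coef_tri_exp_big a b (s := 1) (i := i).
rewrite (big 3) // (big 6) // (big 9) // coef0_tri_exp !mul0r !addr0 mul1r.
rewrite tri_split => /eqP; rewrite expf_eq0 /= => /eqP.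
rewrite (coef3_mul_cube _ _ char3) !coef0_tri_exp coef1_tri_exp (proj1 (coef_tri_sqr a b)).
have s2F : s2%:R = -1 :> F.
  have : (5 * s2 + 2)%:R = 0 :> F by rewrite s2E natrM three0 mul0r.
  rewrite natrD natrM => E; apply: (eq_lincomb (c := -1) E).
  by apply: (eq_lincomb (c := 2%:R * s2%:R + 1) three0); ring.
rewrite s2F expr1n mulr1 mul1r => E.
apply: (mulfI a0); apply: (eq_lincomb (c := 1) E).
by apply: (eq_lincomb (c := a * b) three0); ring.
Qed.

(** * Classification by q modulo 5 for a = 2 t^2 *)

Section Classification.
Variable t : F.
Hypotheses (tF : t \in Fq q F) (t0 : t != 0) (at2 : a = 2%:R * t ^+ 2).

Lemma a_neq0 : a != 0.
Proof. by rewrite at2 mulf_neq0 ?two_neq0 // expf_neq0. Qed.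

(** Here w^2 = -1, a = 2 and b^2 = 1; b = 1 would give h(w) = h(0), so b = -1. *)
Lemma quintic_q3 : q = 3%N -> b != 0 -> 5%:R * b = a ^+ 2.
Proof.
move=> q3 b0; have [w wA w0] := anti_neq0_ex.
have qm : q.-1 = 2%N by rewrite q3.
have w2 : w ^+ 2 = -1 by have := exprq1_anti wA w0; rewrite qm.
have b2 : b ^+ 2 = 1 by have := exprq1_Fq bF b0; rewrite qm.
have t2 : t ^+ 2 = 1 by have := exprq1_Fq tF t0; rewrite qm.
have three0 : 3%:R = 0 :> F by rewrite -[X in X%:R]q3 natq0.
have b1 : b != 1.
  apply: contra w0 => /eqP b1; apply/eqP; apply: h_inj => //.
    by rewrite inE expr0n oppr0; case: (q) q_odd.
  have -> : quintic a b w = w * ((w ^+ 2) ^+ 2 + a * w ^+ 2 + b) by rewrite /quintic; ring.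
  rewrite w2 b1 at2 t2 /quintic !expr0n /= !mulr0 !addr0.
  by apply: (eq_lincomb (c := 0) three0); ring.
have : (b - 1) * (b + 1) == 0 by rewrite -subr_sqr b2 expr1n subrr.
rewrite mulf_eq0 subr_eq0 (negbTE b1) /= => /eqP bm.
rewrite at2 exprMn t2; apply: (eq_lincomb (c := 5%:R) bm).
by apply: (eq_lincomb (c := - 3%:R) three0); ring.
Qed.

Lemma quintic_q13 : q = 13%N -> 5%:R * b != 2%:R * a ^+ 2.
Proof.
move=> q13; apply/eqP => b2.
have n13 : 13%:R = 0 :> F by rewrite -[X in X%:R]q13 natq0.
have [r r2] : exists r : F, r ^+ 2 = 2%:R by apply: sqrt_Fq; rewrite inE natrXq.
(* Modulo 13, 2^6 = -1, so r^q = -r. *)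
have rA : r * t \in antiFq q F.
  move: tF; rewrite !inE exprMn => /eqP ->.
  have -> : r ^+ q = (r ^+ 2) ^+ 6 * r by rewrite -exprM -exprSr q13.
  rewrite r2; apply/eqP; apply: (eq_lincomb (c := 5%:R * r * t) n13); ring.
have bE : b = - t ^+ 4.
  move: b2; rewrite at2 => b2; apply: (eq_lincomb (c := 8%:R) b2).
  by apply: (eq_lincomb (c := - 3%:R * b + 5%:R * t ^+ 4) n13); ring.
have r4A : 4%:R * (r * t) \in antiFq q F.
  by move: rA; rewrite !inE (exprMn _ 4%:R) natrXq => /eqP ->; rewrite mulrN.
have rNA : - (r * t) \in antiFq q F.
  by move: rA; rewrite !inE exprNq => /eqP ->.
(* [r * t] has square [2 t^2], and [4] and [-1] give a collision modulo 13. *)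
have H : quintic a b (4%:R * (r * t)) = quintic a b (- (r * t)).
  have E : (r * t) ^+ 2 = 2%:R * t ^+ 2 by rewrite exprMn r2.
  have q2 c : quintic a b (c * (r * t)) =
              c * (r * t) * t ^+ 4 * (4%:R * c ^+ 4 + 4%:R * c ^+ 2 - 1).
    rewrite /quintic at2 bE.
    apply: (eq_lincomb (c := c * (r * t) * (c ^+ 4 * ((r * t) ^+ 2 + 2%:R * t ^+ 2) +
      2%:R * t ^+ 2 * c ^+ 2)) E); ring.
  rewrite -mulN1r !q2.
  by apply: (eq_lincomb (c := 335%:R * (r * t) * t ^+ 4) n13); ring.
have /eqP := h_inj r4A rNA H; rewrite -addr_eq0 -[X in _ + X]mul1r -mulrDl.
rewrite -(natrD _ 4 1) !mulf_eq0 (negbTE t0) orbF => /orP[/eqP n5|/eqP r0].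
  have /eqP := oner_neq0 F; apply; apply: (eq_lincomb (c := 2%:R) n13).
  by apply: (eq_lincomb (c := - 5%:R) n5); ring.
by move/eqP: r2; rewrite r0 expr0n eq_sym (negbTE two_neq0).
Qed.

Lemma quintic_mod5_23 : (q %% 5 = 2)%N \/ (q %% 5 = 3)%N -> (q = 3%N -> b != 0) ->
  5%:R * b = a ^+ 2.
Proof.
move=> qm b0; have a0 := a_neq0.
have [q3|q3] := eqVneq q 3%N; first by apply: quintic_q3; auto.
have [p3|p3] := eqVneq p 3%N.
  by case: qm => qm; [apply: quintic_p3_mod5_2 | apply: quintic_p3_mod5_3].
case: qm => qm; first exact: quintic_mod5_2.
have [p2|p2] := eqVneq (p %% 5)%N 2%N; first exact: quintic_mod5_3_p2.
(* Powers of a residue 0, 1 or 4 modulo 5 never reach 2 or 3. *)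
have pm3 : (p %% 5 = 3)%N.
  have powE n : (p ^ n.+1 %% 5 = (p %% 5) * (p ^ n %% 5) %% 5)%N.
    by rewrite expnS modnMm.
  have pow4 : (p %% 5 = 4)%N -> forall n, (p ^ n %% 5 = 1)%N \/ (p ^ n %% 5 = 4)%N.
    move=> p4; elim=> [|n IHn]; first by left.
    by rewrite powE p4; case: IHn => ->; [right | left].
  have pow1 : (p %% 5 = 1)%N -> forall n, (p ^ n %% 5 = 1)%N.
    by move=> p1; elim=> [|n IHn] //; rewrite powE p1 IHn.
  have pow0 : (p %% 5 = 0)%N -> (p ^ k.-1.+1 %% 5 = 0)%N by move=> p0; rewrite powE p0 mul0n.
  rewrite prednK // -qE qm in pow0; move: qm p2; rewrite qE => qm.
  have : (p %% 5 < 5)%N by rewrite ltn_mod.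
  case: (p %% 5)%N pow4 pow1 pow0 => [|[|[|[|[|]]]]] // pow4 pow1 pow0 _ _.
  - by have := pow0 erefl.
  - by have := pow1 erefl k; rewrite qm.
  - by case: (pow4 erefl k); rewrite qm.
exact: quintic_mod5_3 qm pm3 p3 quintic_q13.
Qed.

Lemma biquad_sqr (w : F) : 5%N \in [pchar F] -> w \in antiFq q F -> w != 0 ->
  (biquad a b).[w] ^+ (q.-1)./2 = 1.
Proof.
move=> char5 wA w0; have n5 : 5%:R = 0 :> F := pcharf0 char5.
pose D := w ^+ 4 - a * w ^+ 2 + b.
have -> : (biquad a b).[w] = D by rewrite /biquad !(hornerD, hornerN, hornerZ, hornerXn, hornerC).
have DF : D \in Fq q F.
  move: wA aF bF; rewrite !inE /D => /eqP wq /eqP aq /eqP bq.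
  rewrite !exprDq exprNq (exprMn q a) (exprAC _ 4) (exprAC _ 2) wq aq bq.
  by apply/eqP; ring.
have Ds (s : F) : s \in antiFq q F -> D + (t * s) ^+ 2 != 0.
  move=> sA; apply: contra w0 => /eqP Ds0; apply/eqP.
  have nA n : s + n%:R * w \in antiFq q F.
    move: wA sA; rewrite !inE => /eqP wq /eqP sq.
    by rewrite exprDq (exprMn q n%:R) natrXq wq sq mulrN opprD.
  have H : quintic a b (s + 3%:R * w) = quintic a b (s + 2%:R * w).
    by apply/eqP; rewrite -subr_eq0 (quintic_sub_char5 _ _ n5 at2) Ds0 mulr0.
  have E := h_inj (nA 3) (nA 2) H.
  by apply: (eq_lincomb (c := 1) E); ring.
have antiF0 : 0 \in antiFq q F.
  by rewrite inE oppr0 expr0n; case: (q) q_odd.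
have D0 : D != 0 by have := Ds 0 antiF0; rewrite mulr0 expr0n addr0.
have qhalf : ((q.-1)./2 * 2 = q.-1)%N.
  by rewrite muln2; have := odd_double_half q; rewrite q_odd => <-; rewrite /= doubleK.
have : (D ^+ (q.-1)./2 - 1) * (D ^+ (q.-1)./2 + 1) == 0.
  by rewrite -subr_sqr -exprM qhalf exprq1_Fq // expr1n subrr.
rewrite mulf_eq0 subr_eq0 => /orP[/eqP // | /eqP Dm].
have [r r2] := sqrt_Fq DF.
have rA : r \in antiFq q F.
  rewrite inE -[X in r ^+ X](prednK (ltnW (ltnW q_gt2))) exprSr -qhalf mulnC exprM r2.
  by apply/eqP; apply: (eq_lincomb (c := r) Dm); ring.
(* For this element of L, [Ds] would require D + 4 r^2 = 5 D to be nonzero. *)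
have rtA : 2%:R * r / t \in antiFq q F.
  move: rA tF; rewrite !inE => /eqP rq /eqP tq.
  by rewrite !exprMn exprVn natrXq rq tq mulrN mulNr.
have /eqP[] := Ds _ rtA.
have -> : (t * (2%:R * r / t)) ^+ 2 = 4%:R * r ^+ 2 by field.
by rewrite r2; apply: (eq_lincomb (c := D) n5); ring.
Qed.

Lemma quintic_char5 : 5%N \in [pchar F] -> a ^+ 2 = 4%:R * b.
Proof.
move=> char5; have n5 : 5%:R = 0 :> F := pcharf0 char5.
pose N := (q.-1)./2; have NE : (2 * N = q.-1)%N.
  by rewrite /N mul2n; have := odd_double_half q; rewrite q_odd => <-; rewrite /= doubleK.
have N_half : 2%:R * N%:R = -1 :> F.
  rewrite -natrM NE; apply/eqP; rewrite -addr_eq0 natr1 prednK ?natq0 //.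
  by rewrite ltnW // ltnW // q_gt2.
have q5 : (5 <= q)%N.
  have <- : p = 5%N by move: char5; rewrite (pcharf_eq pchar_F) inE => /eqP.
  by rewrite qE -[X in (X <= _)%N]expn1 leq_exp2l // prime_gt1.
have lead : (biquad a b ^+ N)`_(2 * q.-1) = 1.
  by rewrite -NE mulnA (lead_coef_biquad_exp a b N).
have sz : size (biquad a b ^+ N) = (2 * q.-1).+1.
  by rewrite (size_biquad_exp a b N) -NE mulnA.
have rec := coef_biquad_exp_rec a b two_neq0 N_half.
have rec2 := coef2_biquad_exp a b two_neq0 N_half.
have E1 (z : F) : z \in antiFq q F -> z != 0 -> (biquad a b ^+ N).[z] = 1.
  by move=> zA z0; rewrite horner_exp biquad_sqr.
move: (biquad a b ^+ N) lead sz rec rec2 E1 => E lead sz rec rec2 E1.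
have antiF0 : 0 \in antiFq q F.
  by rewrite inE oppr0 expr0n; case: (q) q_odd.
(* Only z = 0 contributes to the sum over L, which [sum_anti_poly] also evaluates. *)
have sum0 (P : {poly F}) : (size P <= 3 * q.-1)%N ->
    (forall z, z \in antiFq q F -> z != 0 -> P.[z] = 0) ->
    P`_0 = P`_(q.-1) - P`_(2 * q.-1).
  move=> szP P0; rewrite -sum_anti_poly // (bigD1 0) //= big1 ?addr0 ?horner_coef0 //.
  by move=> z /andP[]; apply: P0.
pose EN := E - 1%:P.
have szEN : (size EN <= (2 * q.-1).+1)%N.
  rewrite (leq_trans (size_polyD _ _)) // geq_max sz leqnn size_polyN.
  by rewrite (leq_trans (size_polyC_leq1 _)).
have EN0 (z : F) : z \in antiFq q F -> z != 0 -> EN.[z] = 0.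
  by move=> zA z0; rewrite hornerD hornerN hornerC E1 // subrr.
have ENE n : (0 < n)%N -> EN`_n = E`_n.
  by case: n => // n _; rewrite coefB coefC subr0.
have e0 : E`_0 = E`_(q.-1).
  have -> : E`_0 = EN`_0 + 1 by rewrite coefB coefC subrK.
  rewrite (sum0 _ _ EN0); last by apply: leq_trans szEN _; have := q_gt2; lia.
  by rewrite !ENE ?muln_gt0 ?q1_gt0 // lead subrK.
have ei i j : (0 < i)%N -> (0 < j)%N -> (i + j = q.-1)%N -> E`_i = E`_(i + q.-1).
  move=> i_gt0 j_gt0 ijE.
  (* Multiplying by X^j moves the coefficients i and i + (q - 1) to q - 1 and 2 (q - 1), and makes
     the constant term 0. *)
  have := sum0 ('X^j * EN); rewrite !coefXnM j_gt0 -ijE !ltnNge leq_addl.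
  have -> : (j <= 2 * (i + j))%N by lia.
  have -> : (i + j - j = i)%N by lia.
  have -> : (2 * (i + j) - j = i + (i + j))%N by lia.
  rewrite /= !ENE ?addn_gt0 ?i_gt0 // => /(_ _ _)/esym/eqP; rewrite subr_eq0 => H.
  apply/eqP/H; last by move=> z zA z0; rewrite hornerM EN0 // mulr0.
  rewrite (leq_trans (size_polyMleq _ _)) // size_polyXn addSn /=.
  by move: szEN; rewrite -ijE; move: (size EN) => n; lia.
exact: biquad_recurrence_solve natq0 q5 a_neq0 rec rec2 lead e0 ei.
Qed.

End Classification.
End Necessity.

(** * Sufficiency *)

Lemma five_nonsquare (r : F) : (q %% 5 = 2)%N \/ (q %% 5 = 3)%N -> r \in Fq q F ->
  r ^+ 2 != 5%:R.
Proof.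
move=> qm rF; apply/eqP => r2; have n2 := two_neq0.
have p5 : p != 5%N.
  apply/eqP => p5; have : (5 %| q)%N by rewrite qE p5 dvdn_exp.
  by rewrite /dvdn; case: qm => ->.
have n5 : 5%:R != 0 :> F by apply: prime_neq0.
(* [e] plays the role of [z + 1 / z] for a primitive fifth root of unity [z]. *)
pose e := (r - 1) / 2%:R.
have eE : e ^+ 2 + e = 1.
  by apply: (eq_lincomb (c := 4%:R^-1) r2); rewrite /e; field; rewrite (natrM _ 2 2) mulf_neq0.
have eF : e ^+ 2 - 4%:R \in Fq q F.
  move: rF; rewrite !inE => /eqP rq.
  by rewrite exprDq exprNq natrXq (exprAC e) /e exprMn exprVn natrXq exprDq exprNq expr1n rq.
have [v v2] := sqrt_Fq eF; pose z := (e + v) / 2%:R.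
have zE : z ^+ 2 - e * z + 1 = 0.
  by apply: (eq_lincomb (c := 4%:R^-1) v2); rewrite /z; field; rewrite (natrM _ 2 2) mulf_neq0.
have z4 : z ^+ 4 + z ^+ 3 + z ^+ 2 + z + 1 = 0.
  apply: (eq_lincomb (c := z ^+ 2 + (1 + e) * z + 1) zE).
  by apply: (eq_lincomb (c := z ^+ 2) eE); ring.
have z5 : z ^+ 5 = 1 by apply: (eq_lincomb (c := z - 1) z4); ring.
(* As q^2 = 4 modulo 5, z^(q^2) = z forces z^3 = 1, and z^5 = 1 then gives z = 1. *)
have zq : z ^+ (q ^ 2) = z ^+ 4.
  rewrite (divn_eq (q ^ 2) 5) exprD mulnC exprM z5 expr1n mul1r; congr (_ ^+ _).
  by rewrite -modnXm; case: qm => ->.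
have z3 : z ^+ 6 = 1.
  have z0 : z != 0 by apply: contra_eq_neq z5 => ->; rewrite expr0n eq_sym oner_eq0.
  have := expf_card z; rewrite cardF zq => z41.
  have z31 : z ^+ 3 = 1 by apply: (mulfI z0); rewrite -exprS z41 mulr1.
  by rewrite (exprM _ 3 2) z31 expr1n.
have z1 : z = 1 by rewrite -z3 exprS z5 mulr1.
rewrite z1 !expr1n in z4; move/eqP: n5; apply.
by apply: (eq_lincomb (c := 1) z4); ring.
Qed.

Lemma anti_sub (y z : F) : y \in antiFq q F -> z \in antiFq q F -> y - z \in antiFq q F.
Proof. by rewrite !inE exprDq exprNq => /eqP -> /eqP ->; rewrite opprD. Qed.

Lemma anti_add (y z : F) : y \in antiFq q F -> z \in antiFq q F -> y + z \in antiFq q F.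
Proof. by rewrite !inE exprDq => /eqP -> /eqP ->; rewrite opprD. Qed.

Lemma quintic_inj_mod5_23 : (q %% 5 = 2)%N \/ (q %% 5 = 3)%N -> 5%:R * b = a ^+ 2 ->
  {in antiFq q F &, injective (quintic a b)}.
Proof.
move=> qm b5 y z yA zA H; apply/eqP; rewrite -subr_eq0; apply/negP => /negP w0.
have wA := anti_sub yA zA; have sA := anti_add yA zA.
set w := y - z in w0 wA; set s := y + z in sA.
(* The quotient (h(y) - h(z)) / (y - z) is quadratic in y z; [r] completes its square, and 5 b = a^2
   makes 5 times the discriminant a square. *)
pose r := 2%:R * (y * z) - (3%:R * s ^+ 2 + a).
have rF : r \in Fq q F.
  move: aF yA zA sA; rewrite !inE /r => /eqP aq /eqP yq /eqP zq /eqP sq.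
  rewrite !(exprDq, exprNq) (exprMn q 2%:R) (exprMn q y) (exprMn q 3%:R) !natrXq.
  by rewrite (exprAC s) aq yq zq sq mulrNN sqrrN.
have ratio u v : u \in antiFq q F -> v \in antiFq q F -> u / v \in Fq q F.
  by rewrite !inE exprMn exprVn => /eqP -> /eqP ->; rewrite invrN mulrNN.
have E0 : (y * z) ^+ 2 - (3%:R * s ^+ 2 + a) * (y * z) + s ^+ 4 + a * s ^+ 2 + b = 0.
  apply: (mulfI w0); rewrite mulr0; apply: (eq_lincomb (c := 1) H).
  by rewrite /quintic /w /s; ring.
have r2 : 5%:R * r ^+ 2 = (5%:R * s ^+ 2 + a) ^+ 2.
  apply: (eq_lincomb (c := 20%:R) E0); rewrite /r.
  by apply: (eq_lincomb (c := - 4%:R) b5); ring.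
have [r0 | r_neq0] := eqVneq r 0; last first.
  have : (5%:R * s ^+ 2 + a) / r \in Fq q F.
    move: rF aF sA; rewrite !inE => /eqP rq /eqP aq /eqP sq.
    by rewrite exprMn exprVn exprDq (exprMn q 5%:R) natrXq (exprAC s) sq aq rq sqrrN.
  by move/(five_nonsquare qm)/eqP; apply; rewrite expr_div_n -r2 mulfK // expf_neq0.
(* In the degenerate case r = 0, the ratio w / s is the square root of 5. *)
have as2 : 5%:R * s ^+ 2 + a = 0.
  by apply/eqP; rewrite -sqrf_eq0 -r2 r0 expr0n mulr0.
have w2 : w ^+ 2 = 5%:R * s ^+ 2.
  apply: (eq_lincomb (c := - 2%:R) r0); apply: (eq_lincomb (c := - 2%:R) as2).
  by rewrite /r /w /s; ring.
have s0 : s != 0.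
  by apply: contra w0 => /eqP s0; rewrite -sqrf_eq0 w2 s0 expr0n mulr0.
have /(five_nonsquare qm)/eqP := ratio _ _ wA sA; apply.
by rewrite expr_div_n w2 mulfK // expf_neq0.
Qed.

Lemma quintic_inj_char5 (t : F) : 5%:R = 0 :> F -> t \in Fq q F -> t != 0 ->
  a = 2%:R * t ^+ 2 -> a ^+ 2 = 4%:R * b ->
  {in antiFq q F &, injective (quintic a b)}.
Proof.
move=> n5 tF t0 at2 ab y z yA zA H; apply/eqP; rewrite -subr_eq0; apply/negP => /negP w0.
have wA := anti_sub yA zA; set w := y - z in w0 wA.
have bE : b = t ^+ 4.
  apply: (eq_lincomb (c := 1) ab); apply: (eq_lincomb (c := b - t ^+ 4) n5).
  by rewrite at2; ring.
(* In characteristic 5 this is the midpoint of y and z. *)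
pose s := 3%:R * z - 2%:R * y.
have sA : s \in antiFq q F.
  apply: anti_sub; [move: zA | move: yA]; rewrite !inE exprMn natrXq => /eqP ->.
    by rewrite mulrN.
  by rewrite mulrN.
have := quintic_sub_char5 s w n5 at2.
have -> : s + 3%:R * w = y by rewrite /s /w; ring.
have -> : s + 2%:R * w = z by rewrite /s /w; ring.
rewrite H subrr => /esym/eqP; rewrite mulf_eq0 (negbTE w0) /= => /eqP E.
have : (w ^+ 2 - t ^+ 2 - 2%:R * t * s) * (w ^+ 2 - t ^+ 2 + 2%:R * t * s) == 0.
  apply/eqP; apply: (eq_lincomb (c := 1) E).
  by apply: (eq_lincomb (c := - (t * s) ^+ 2) n5); rewrite at2 bE; ring.
have wtF : w ^+ 2 - t ^+ 2 \in Fq q F.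
  move: wA tF; rewrite !inE => /eqP wq /eqP tq.
  by rewrite exprDq exprNq !(exprAC _ 2) wq tq sqrrN.
have tsA : 2%:R * t * s \in antiFq q F.
  move: sA tF; rewrite !inE => /eqP sq /eqP tq.
  by rewrite !exprMn natrXq sq tq mulrN.
have tsNA : - (2%:R * t * s) \in antiFq q F.
  by move: tsA; rewrite !inE exprNq => /eqP ->.
move=> wt; have : w ^+ 2 - t ^+ 2 = 0.
  apply: Fq_anti0 => //; move: wt; rewrite mulf_eq0 subr_eq0 addr_eq0.
  by case/orP => /eqP ->.
move/eqP; rewrite subr_sqr mulf_eq0 subr_eq0 addr_eq0 => wt'.
have wF : w \in Fq q F.
  by case/orP: wt' => /eqP -> //; move: tF; rewrite !inE exprNq => /eqP ->.
by move: w0; rewrite (Fq_anti0 wF wA) eqxx.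
Qed.

(** * Reduction to the quintic *)

Section Reduction.
Variables (delta gamma t : F).
Hypotheses (gammaF : gamma \in Fq q F) (gamma0 : gamma != 0) (t0 : t != 0).
Hypotheses (tE : Tr q delta = 2%:R * t) (at2 : a = 2%:R * t ^+ 2).
Hypothesis bE : 4%:R * t * b = gamma - 12%:R * t ^+ 5.

Let y (x : F) := x ^+ q - x + delta.
Let fval (x : F) := y x ^+ (2 * q + 4) + y x ^+ (q + 5) + gamma * x.

Lemma half_trace_Fq : t \in Fq q F.
Proof.
have : (2%:R * t) ^+ q = 2%:R * t by rewrite -tE /Tr exprDq exprqK addrC.
by rewrite exprMn natrXq inE => /(mulfI two_neq0) ->.
Qed.

Lemma y_sub_anti x : y x - t \in antiFq q F.
Proof.
have /eqP tq := half_trace_Fq.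
rewrite inE /y; apply/eqP; rewrite exprDq exprNq !exprDq exprNq exprqK tq.
by apply: (eq_lincomb (c := 1) tE); rewrite /Tr; ring.
Qed.

Lemma fvalE x : fval x = 2%:R * t * (t - (y x - t)) * (y x) ^+ 4 + gamma * x.
Proof.
have /eqP tq := half_trace_Fq; have := y_sub_anti x; rewrite inE => /eqP yq.
have {}yq : y x ^+ q = 2%:R * t - y x.
  by rewrite -{1}(subrK t (y x)) exprDq yq tq; ring.
by rewrite /fval (exprD _ (2 * q)) (exprD _ q) mulnC exprM yq; ring.
Qed.

Lemma fval_frobenius x :
  fval x ^+ q - fval x = 4%:R * t * quintic a b (y x - t) + gamma * (t - delta).
Proof.
have /eqP tq := half_trace_Fq; have := y_sub_anti x; rewrite inE => /eqP zq.
have /eqP gq := gammaF; set z := y x - t in zq *.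
have xq : x ^+ q = x + z + t - delta by rewrite /z /y; ring.
have yE : y x = t + z by rewrite /z; ring.
rewrite fvalE -/z; clearbody z; rewrite yE exprDq (exprMn q _ ((t + z) ^+ 4)) (exprMn q _ (t - z)).
rewrite (exprMn q 2%:R) (exprMn q gamma) natrXq gq xq (exprAC _ 4).
rewrite !exprDq exprNq zq tq.
have -> : 4%:R * t * quintic a b z =
          4%:R * t * (z ^+ 5 + a * z ^+ 3) + (4%:R * t * b) * z by rewrite /quintic; ring.
by rewrite bE at2; ring.
Qed.

Lemma fval_shift x c : c \in Fq q F -> fval (x + c) = fval x + gamma * c.
Proof.
rewrite inE => /eqP cq; have yc : y (x + c) = y x by rewrite /y exprDq cq; ring.
by rewrite /fval yc mulrDr addrA.
Qed.

(** For the forward direction, a collision of h lifts to x1, x2 with f(x1) - f(x2) = gamma c, c in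
    F_q. The shift by c absorbs this, so x1 = x2 + c and both have the same y. *)
Lemma fval_inj : injective fval <-> {in antiFq q F &, injective (quintic a b)}.
Proof.
have n2 := two_neq0; have n4 : 4%:R != 0 :> F by rewrite (natrM _ 2 2) mulf_neq0.
split=> [f_inj z1 z2 z1A z2A H | h_inj x1 x2 H]; last first.
  have zz : quintic a b (y x1 - t) = quintic a b (y x2 - t).
    have : 4%:R * t != 0 by rewrite mulf_neq0.
    by move/mulfI; apply; apply: (addIr (gamma * (t - delta))); rewrite -!fval_frobenius H.
  have yy := addIr _ (h_inj _ _ (y_sub_anti x1) (y_sub_anti x2) zz).
  by move: H; rewrite /fval yy => /addrI /(mulfI gamma0).
have preim z : z \in antiFq q F -> exists x, y x = t + z.
  move=> zA; exists (- (z + t - delta) / 2%:R).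
  have tdA : (z + t - delta) ^+ q = - (z + t - delta).
    have /eqP tq := half_trace_Fq; move: zA; rewrite inE => /eqP zq.
    rewrite !exprDq exprNq zq tq.
    by apply: (eq_lincomb (c := - 1) tE); rewrite /Tr; ring.
  by rewrite /y mulNr exprNq exprMn exprVn natrXq tdA; field.
have [x1 y1] := preim z1 z1A; have [x2 y2] := preim z2 z2A.
have tz z : t + z - t = z by rewrite addrC addKr.
pose c := (fval x1 - fval x2) / gamma.
have cF : c \in Fq q F.
  have E : fval x1 ^+ q - fval x1 = fval x2 ^+ q - fval x2.
    by rewrite !fval_frobenius y1 y2 !tz H.
  rewrite inE /c exprMn exprVn exprDq exprNq; have /eqP -> := gammaF.
  by apply/eqP; congr (_ / _); apply: (eq_lincomb (c := 1) E); ring.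
have x12 : x1 = x2 + c.
  by apply: f_inj; rewrite fval_shift // /c mulrCA divff // mulr1 addrC subrK.
have y12 : y x1 = y x2.
  by rewrite x12 /y exprDq; move: cF; rewrite inE => /eqP ->; ring.
by apply: (addrI t); rewrite -y1 -y2.
Qed.

Lemma quintic_inj_iff : {in antiFq q F &, injective (quintic a b)} <->
  ((q %% 5 = 2)%N \/ (q %% 5 = 3)%N) /\ 5%:R * b = a ^+ 2 \/
  (5 %| q)%N /\ a ^+ 2 = 4%:R * b.
Proof.
have tF := half_trace_Fq.
have char5 : (5 %| q)%N -> 5%N \in [pchar F].
  by rewrite qE Euclid_dvdX // => /andP[]; rewrite dvdn_prime2 // => /eqP ->; rewrite pchar_F.
split=> [h_inj | [[qm ab] | [q5 ab]]]; last first.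
- exact: quintic_inj_char5 (pcharf0 (char5 q5)) tF t0 at2 ab.
- exact: quintic_inj_mod5_23.
have n1 := q_mod5_neq1 h_inj; have n4 := q_mod5_neq4 h_inj (a_neq0 t0 at2).
(* In characteristic 3 the term 12 t^5 vanishes, so b = 0 would give gamma = 0. *)
have b_q3 : q = 3%N -> b != 0.
  move=> q3; have three0 : 3%:R = 0 :> F by rewrite -[X in X%:R]q3 natq0.
  apply: contra gamma0 => /eqP b0; apply/eqP; move: bE; rewrite b0 mulr0 => E.
  by apply: (eq_lincomb (c := - 1) E); apply: (eq_lincomb (c := 4%:R * t ^+ 5) three0); ring.
have q23 : (q %% 5 = 2)%N \/ (q %% 5 = 3)%N ->
    ((q %% 5 = 2)%N \/ (q %% 5 = 3)%N) /\ 5%:R * b = a ^+ 2.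
  by move=> qm; split=> //; apply: (quintic_mod5_23 h_inj tF t0 at2).
have := ltn_pmod q (isT : 0 < 5)%N; move: n1 n4 q23; rewrite /dvdn.
case E : (q %% 5)%N => [|[|[|[|[|]]]]] // _ _ q23 _.
- by right; split=> //; apply: (quintic_char5 h_inj tF t0 at2); apply: char5; rewrite /dvdn E.
- by left; apply: q23; left.
- by left; apply: q23; right.
Qed.

End Reduction.

End QuadraticExtension.

(** * Conditions in terms of gamma and the trace *)

Theorem theorem3p8 (p k q : nat) (hp : prime p) (hk : (0 < k)%N)
    (hq : q = (p ^ k)%N) (hodd : odd q)
    (F : finFieldType) (hF : #|F| = (q ^ 2)%N)
    (delta gamma : F) (hgammaFq : gamma \in Fq q F) (hgamma0 : gamma != 0) :
  let y : {poly F} := 'X^q - 'X + delta%:P in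
  let f : {poly F} := y ^+ (2 * q + 4) + y ^+ (q + 5) + gamma *: 'X in
  permutation_poly f <->
    [\/ Tr q delta = 0,
        [/\ Tr q delta <> 0,
            (q = 2 %[mod 5])%N \/ (q = 3 %[mod 5])%N &
            40%:R * gamma = 19%:R * Tr q delta ^+ 5]
      | [/\ Tr q delta <> 0,
            (5 %| q)%N &
            2%:R * gamma = Tr q delta ^+ 5]].
Proof.
move=> y f.
pose g (x : F) := (x ^+ q - x + delta) ^+ (2 * q + 4) + (x ^+ q - x + delta) ^+ (q + 5) + gamma * x.
have fE x : f.[x] = g x.
  by rewrite /f /y /g !(hornerD, hornerN, hornerZ, horner_exp, hornerXn, hornerX, hornerC).
have perm_inj : permutation_poly f <-> injective g.
  split=> [/bij_inj f_inj x z | g_inj]; first by rewrite -!fE; apply: f_inj.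
  by apply: injF_bij => x z; rewrite !fE; apply: g_inj.
have n2 : 2%:R != 0 :> F := two_neq0 hp hk hq hodd hF.
have n4 : 4%:R != 0 :> F by rewrite (natrM _ 2 2) mulf_neq0.
have n8 : 8%:R != 0 :> F by rewrite (natrM _ 2 4) mulf_neq0.
pose t := Tr q delta / 2%:R; have tE : Tr q delta = 2%:R * t by rewrite /t; field.
have [T0 | T0] := eqVneq (Tr q delta) 0.
  split=> _; first by constructor.
  (* [fvalE] also covers t = 0, where only gamma x survives. *)
  apply/perm_inj => x z; rewrite /g !(fvalE hp hk hq hodd hF gamma tE) -!tE T0 !mul0r !add0r.
  exact: mulfI.
have t0 : t != 0 by rewrite mulf_neq0 ?invr_eq0.
have tF := half_trace_Fq hp hk hq hodd hF tE.
pose a := 2%:R * t ^+ 2; pose b := (gamma - 12%:R * t ^+ 5) / (4%:R * t).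
have n4t : 4%:R * t != 0 by rewrite mulf_neq0.
have bE : 4%:R * t * b = gamma - 12%:R * t ^+ 5 by rewrite /b mulrC divfK.
have natF n := natrXq hp hq hodd hF n.
have addq := exprDq hp hq hF; have oppq := @exprNq q F hodd.
have aF : a \in Fq q F.
  by move: tF; rewrite !inE /a => /eqP tq; rewrite exprMn natF exprAC tq.
have bF : b \in Fq q F.
  move: tF hgammaFq; rewrite !inE /b => /eqP tq /eqP gq.
  rewrite exprMn exprVn addq oppq (exprMn q 12%:R) (exprMn q 4%:R) !natF (exprAC t).
  by rewrite tq gq.
(* With 4 t b = gamma - 12 t^5, this reads 40 gamma = 608 t^5 = 19 (2 t)^5; similarly [case_iii]
   reads gamma = 16 t^5. *)
have case_ii : 5%:R * b = a ^+ 2 <-> 40%:R * gamma = 19%:R * Tr q delta ^+ 5.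
  rewrite tE /a; split=> E.
    apply: (eq_lincomb (c := 32%:R * t) E).
    by apply: (eq_lincomb (c := - 40%:R) bE); ring.
  apply: (mulfI n8); apply: (mulfI n4t); apply: (eq_lincomb (c := 1) E).
  by apply: (eq_lincomb (c := 40%:R) bE); ring.
have case_iii : a ^+ 2 = 4%:R * b <-> 2%:R * gamma = Tr q delta ^+ 5.
  rewrite tE /a; split=> E.
    apply: (eq_lincomb (c := - (2%:R * t)) E).
    by apply: (eq_lincomb (c := - 2%:R) bE); ring.
  apply: (mulfI n2); apply: (mulfI t0); apply: (eq_lincomb (c := -1) E).
  by apply: (eq_lincomb (c := - 2%:R) bE); ring.
have inj_iff := fval_inj hp hk hq hodd hF hgammaFq hgamma0 t0 tE erefl bE.
have crit := quintic_inj_iff hp hk hq hodd hF aF bF hgamma0 t0 tE erefl bE.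
have Tneq : Tr q delta <> 0 by apply/eqP.
split=> [/perm_inj/inj_iff/crit [[qm /case_ii E]|[q5 /case_iii E]] | ].
- by apply: Or32.
- by apply: Or33.
move=> H; apply/perm_inj/inj_iff/crit; case: H => [// | [_ qm /case_ii E] | [_ q5 /case_iii E]].
- by left.
- by right.
Qed.
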